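(* Let $\kappa>0$, $L>0$, $c\in\mathbb{R}\setminus\{0\}$, and let the on-site potential be $$V(x)=-\frac{\omega_0^2}{2}x^2+\frac{a}{p+1}x^{p+1},\qquad a>0,\ p>1,$$ where $p$ is an odd integer. Let either (i) $\omega_0^2\ge 4\kappa$, or (ii) $\omega_0^2<4\kappa$ and $c^2>C(L)(4\kappa-\omega_0^2)$, where $C(L)=L^2/\pi^2$. Then the system $$\frac{d^2 q_n}{dt^2}=\kappa(q_{n+1}-2q_n+q_{n-1})-V'(q_n)$$ on the periodic lattice $-L\le n\le L$ has at least one nontrivial periodic travelling wave solution $q_n(t)=Q(n-ct)$.
   Context: The finite lattice consists of oscillators placed equidistantly on an interval of length $2L$ (positions $x_n=-L+nh$, $h=2L/N$, $\kappa=1/2h^2$), with periodic boundary conditions $q_n=q_{n+N}$. A periodic travelling wave solution (TWS) with velocity $c$ has the form $q_n(t)=Q(n-ct)=Q(z)$ with $Q$ a $2L$-periodic function; it satisfies the advance-delay equation $$c^2Q''(z)=\kappa\,(Q(z+1)-2Q(z)+Q(z-1))-V'(Q(z)).$$ One considers periodic TWSs of zero mean, $\int_{-L}^LQ(z)\,dz=\int_{-L}^LV'(Q(z))\,dz=0$, i.e. performing oscillations about $Q=0$; they are sought in the space $\mathcal{X}_1$ of $2L$-periodic $Q\in H^1_{per}(-L,L)$ with $\int_{-L}^LQ\,ds=\int_{-L}^LV'(Q(s))\,ds=0$ and $Q(s-L/2)=-Q(L/2-s)$. $C(L)=L^2/\pi^2$ is the optimal constant in the Poincaré inequality $\int_{-L}^LQ^2ds\le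 C(L)\int_{-L}^L(Q')^2ds$ on $\mathcal{X}_1$. Nontrivial means $Q\not\equiv0$. *)

(* Defs.v *)
From mathcomp Require Import all_boot all_order all_algebra.
From mathcomp Require Import all_classical all_reals all_analysis.
Set Implicit Arguments.
Unset Strict Implicit.
Unset Printing Implicit Defensive.
Import Order.TTheory GRing.Theory Num.Theory.
Import numFieldNormedType.Exports.

Local Open Scope ring_scope.
Local Open Scope classical_set_scope.

Definition potential (R : realType) (omega0 a : R) (p : nat) (x : R) : R :=
  - (omega0 ^+ 2 / 2) * x ^+ 2 + a / (p.+1)%:R * x ^+ p.+1.

Definition poincare_const (R : realType) (L : R) : R := L ^+ 2 / pi ^+ 2.

Definition L2_interval (R : realType) (L : R) (f : R -> R) : Prop :=
  (patch (cst 0) `[- L, L] f) \in Lfun (@lebesgue_measure R) 2%:E.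

Definition smooth (R : realType) (phi : R -> R) : Prop :=
  forall (k : nat) (x : R), derivable (derive1n k phi) x 1.

(* No boundary terms appear in the weak-derivative identity because Q and the
   test functions are both 2L-periodic. *)
Definition H1per (R : realType) (L : R) (Q : R -> R) : Prop :=
  [/\ periodic Q (2 * L),
      L2_interval L Q &
      exists2 g : R -> R, L2_interval L g &
        forall phi : R -> R, smooth phi -> periodic phi (2 * L) ->
          \int[@lebesgue_measure R]_(x in `[- L, L]) (Q x * derive1 phi x) =
          - \int[@lebesgue_measure R]_(x in `[- L, L]) (g x * phi x)].

Definition X1 (R : realType) (V : R -> R) (L : R) (Q : R -> R) : Prop :=
  [/\ H1per L Q,
      \int[@lebesgue_measure R]_(s in `[- L, L]) Q s = 0,
      \int[@lebesgue_measure R]_(s in `[- L, L]) derive1 V (Q s) = 0 &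
      forall s : R, Q (s - L / 2) = - Q (L / 2 - s)].

(* The sites are indexed by all integers.  The derivability clauses are needed
   because [derive1] is a total operator. *)
Definition lattice_solution (R : realType) (kappa : R) (V : R -> R)
    (q : int -> R -> R) : Prop :=
  forall (n : int) (t : R),
    [/\ derivable (q n) t 1,
        derivable (derive1 (q n)) t 1 &
        derive1n 2 (q n) t =
          kappa * (q (n + 1) t - 2 * q n t + q (n - 1) t) - derive1 V (q n t)].

(* The sites -L <= n <= L form a ring exactly when 2L is an integer N, and then
   q_n = q_(n+N); L itself is only assumed to be real. *)
Definition lattice_periodic (R : realType) (L : R) (q : int -> R -> R) : Prop :=
  forall N : nat, N%:R = 2 * L -> forall n : int, q (n + N%:Z) = q n.

Definition travelling_wave (R : realType) (c : R) (Q : R -> R) (n : int) (t : R) : R :=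
  Q (n%:~R - c * t).

(* Membership in X1 excludes the nonzero constant equilibria of V. *)
Definition periodic_TWS (R : realType) (kappa : R) (V : R -> R) (L c : R)
    (Q : R -> R) : Prop :=
  [/\ X1 V L Q,
      lattice_periodic L (travelling_wave c Q) &
      lattice_solution kappa V (travelling_wave c Q)].

(* Main.v *)
Require Import Defs.
From mathcomp Require Import all_boot all_order all_algebra.
From mathcomp Require Import all_classical all_reals all_analysis.
From mathcomp Require Import measurable_realfun ring lra.
Import Order.TTheory GRing.Theory Num.Theory.
Local Open Scope ring_scope.
Import numFieldNormedType.Exports.
Local Open Scope classical_set_scope.
Set Implicit Arguments.
Unset Strict Implicit.
Unset Printing Implicit Defensive.

(** A profile [Q] of a travelling wave solves
      [- c^2 Q'' + omega0^2 Q + kappa (Q(.+1) - 2 Q + Q(.-1)) = a Q^p],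
    where [p] is odd. The left-hand side is half the gradient of the quadratic
    energy
      [E(u) = int c^2 u'^2 + omega0^2 u^2 - kappa (u(.+1) - u)^2]
    on odd [2L]-periodic functions, with integrals over one period. Both
    alternatives of the hypothesis make this energy control the integral of
    [u'^2] (energy_coercive): the difference term costs at most [4 kappa]
    times the integral of [u^2], which is compensated by [omega0^2] in the first
    case, and in the second one by [omega0^2] together with a part of the
    derivative term, since the functions vanish at the multiples of [L]
    (wirtinger). The right-hand side is, up to a factor, the gradient of the
    integral of [u^(p+1)], a convex functional since [p + 1] is even. So a
    maximizer of this integral on the ball [E(u) <= 1] solves the equation
    up to a multiplicative constant, and rescaling it adjusts the constant.

    The existence of the maximizer is arranged so that only classical
    functions occur. A maximizing sequence of C1 functions is bounded and
    uniformly Hoelder of exponent 1/2, hence converges uniformly along an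
    ultrafilter (holder_compact). Its limit [u] is merely continuous, so its
    energy is not at hand; but the comparison of [u_n] with [u_n + t phi], for a
    C2 test function [phi], involves [u_n] only through integrals of its powers
    against fixed continuous functions (energy_linear_part, maximizing_inequality). It
    therefore passes to the limit, where its first-order term in [t] is the weak
    Euler-Lagrange equation (exists_weak_solution). Finally a weak solution
    coincides, up to the factor [c^2], with the second primitive of the terms
    of the equation that carry no derivative, so it is C2
    (weak_solution_regular). Oddness makes both mean values of the profile and
    of its force vanish. *)

(** * Derivatives, integrals and primitives of continuous functions *)

(** Carrying the derivative as a function, instead of computing it with the
    total operator [derive1], keeps existence and value in one hypothesis. *)
Definition has_derivative (R : realType) (f f' : R -> R) :=
  forall x : R, is_derive x (1 : R) f (f' x).

Section Derivatives.
Variable R : realType.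
Implicit Types (f g : R -> R).

Lemma has_derivative_eq f g f' g' :
  f =1 g -> f' =1 g' -> has_derivative f f' -> has_derivative g g'.
Proof. by move=> /funext-> /funext->. Qed.

Lemma has_derivative_continuous f f' : has_derivative f f' -> continuous f.
Proof.
by move=> df x; apply/differentiable_continuous/derivable1_diffP; case: (df x).
Qed.

Lemma has_derivativeD f g f' g' : has_derivative f f' -> has_derivative g g' ->
  has_derivative (fun x => f x + g x) (fun x => f' x + g' x).
Proof. by move=> df dg x; exact: (@is_deriveD _ _ _ f g x 1 _ _ (df x) (dg x)). Qed.

Lemma has_derivativeZ (k : R) f f' : has_derivative f f' ->
  has_derivative (fun x => k * f x) (fun x => k * f' x).
Proof. by move=> df x; exact: (@is_deriveZ _ _ _ f k x 1 _ (df x)). Qed.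

Lemma has_derivativeB f g f' g' : has_derivative f f' -> has_derivative g g' ->
  has_derivative (fun x => f x - g x) (fun x => f' x - g' x).
Proof. by move=> df dg x; exact: (@is_deriveB _ _ _ f g x 1 _ _ (df x) (dg x)). Qed.

Lemma has_derivativeM f g f' g' : has_derivative f f' -> has_derivative g g' ->
  has_derivative (fun x => f x * g x) (fun x => f' x * g x + f x * g' x).
Proof.
move=> df dg x; apply: is_derive_eq; first exact: (@is_deriveM _ _ f g x 1 _ _ (df x) (dg x)).
by rewrite /GRing.scale /= addrC mulrC.
Qed.

Lemma has_derivative_comp f g f' g' :
  has_derivative f f' -> has_derivative g g' ->
  has_derivative (fun x => f (g x)) (fun x => f' (g x) * g' x).
Proof. by move=> df dg x; exact: (@is_derive1_comp _ f g x _ _ (df (g x)) (dg x)). Qed.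

Lemma has_derivative_cst (k : R) : has_derivative (fun=> k) (fun=> 0).
Proof. by move=> x; exact: is_derive_cst. Qed.

Lemma has_derivative_id : has_derivative (fun x : R => x) (fun=> 1).
Proof. by move=> x; exact: is_derive_id. Qed.

Lemma has_derivative_shift s f f' : has_derivative f f' ->
  has_derivative (fun x => f (x + s)) (fun x => f' (x + s)).
Proof.
move=> df.
apply: has_derivative_eq
  (has_derivative_comp df
    (has_derivativeD has_derivative_id (has_derivative_cst s))) => // x.
by rewrite addr0 mulr1.
Qed.

Lemma has_derivative_opp f f' : has_derivative f f' ->
  has_derivative (fun x => f (- x)) (fun x => - f' (- x)).
Proof.
move=> df.
apply: has_derivative_eq
  (has_derivative_comp df (has_derivativeZ (-1) has_derivative_id)) => x.
  by rewrite mulN1r.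
by rewrite mulr1 mulrN1 mulN1r.
Qed.

Lemma has_derivative0_cst f x y : has_derivative f (fun=> 0) -> f x = f y.
Proof. by move=> df; apply: is_derive_0_is_cst => z; exact: df. Qed.

Lemma has_derivative_unique f g f' : has_derivative f f' ->
  has_derivative g f' -> forall x y, f y - f x = g y - g x.
Proof.
move=> df dg x y.
have dh : has_derivative (fun x => f x - g x) (fun=> 0).
  by apply: has_derivative_eq (has_derivativeB df dg) => // z; rewrite subrr.
by have := has_derivative0_cst y x dh; lra.
Qed.

Lemma has_derivative_ge0_le f f' (a b : R) : has_derivative f f' -> a <= b ->
  (forall x, a < x < b -> 0 <= f' x) -> f a <= f b.
Proof.
move=> df; rewrite le_eqVlt => /predU1P[->//|ab] f'0; rewrite -subr_ge0.
have [x xab ->] := @MVT R f f' a b ab (fun x _ => df x)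
  (continuous_subspaceT (has_derivative_continuous df)).
by rewrite mulr_ge0 ?subr_ge0 ?(ltW ab)// f'0// -in_itv.
Qed.

Lemma derive1_has_derivative f f' : has_derivative f f' -> derive1 f = f'.
Proof. by move=> df; apply/funext => x; rewrite derive1E (@derive_val _ _ _ _ _ _ _ (df x)). Qed.

Lemma continuous_fshift s f : continuous f -> continuous (fun x => f (x + s)).
Proof.
move=> cf x; apply: (@continuous_comp _ _ _ (fun x => x + s) f); last exact: cf.
exact: (has_derivative_continuous (has_derivativeD has_derivative_id (has_derivative_cst s))).
Qed.

Lemma continuous_fD f g : continuous f -> continuous g ->
  continuous (fun x => f x + g x).
Proof. by move=> cf cg x; apply: cvgD; [exact: cf|exact: cg]. Qed.

Lemma continuous_fB f g : continuous f -> continuous g ->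
  continuous (fun x => f x - g x).
Proof. by move=> cf cg x; apply: cvgB; [exact: cf|exact: cg]. Qed.

Lemma continuous_fM f g : continuous f -> continuous g ->
  continuous (fun x => f x * g x).
Proof. by move=> cf cg x; apply: cvgM; [exact: cf|exact: cg]. Qed.

Lemma continuous_fZ (k : R) f : continuous f -> continuous (fun x => k * f x).
Proof. by move=> cf; apply: continuous_fM => // x; exact: cvg_cst. Qed.

Lemma continuous_fX n f : continuous f -> continuous (fun x => f x ^+ n).
Proof.
move=> cf; elim: n => [|n ih].
  by move=> x; under eq_fun do rewrite expr0; exact: cvg_cst.
have -> : (fun x => f x ^+ n.+1) = (fun x => f x * f x ^+ n).
  by apply/funext => x; rewrite exprS.
exact: continuous_fM.
Qed.

End Derivatives.

Section Integrals.
Variable R : realType.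
Local Notation mu := (@lebesgue_measure R).
Implicit Types (f g F : R -> R) (a b : R).

Definition integral_of f a b : R := \int[mu]_(x in `[a, b]) f x.

Lemma continuous_integrable f a b : continuous f ->
  mu.-integrable `[a, b] (EFin \o f).
Proof.
move=> cf; apply: continuous_compact_integrable; first exact: segment_compact.
exact: continuous_subspaceT.
Qed.

Lemma integral_of_derivative f F a b : a <= b -> continuous f ->
  has_derivative F f -> integral_of f a b = F b - F a.
Proof.
rewrite le_eqVlt => /predU1P[-> _ _|ab cf dF].
  by rewrite /integral_of set_itv1 Rintegral_set1 subrr.
have cF := has_derivative_continuous dF.
rewrite /integral_of /Rintegral (continuous_FTC2 ab (continuous_subspaceT cf) (F := F))//.
- split; first by move=> x _; case: (dF x).
  + exact: cvg_at_right_filter (cF a).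
  + exact: cvg_at_left_filter (cF b).
- by move=> x _; rewrite (derive1_has_derivative dF).
Qed.

(** The integral of [f] from 0 to [x], with its sign when [x] is negative: a
    primitive on the whole line, with no base point to the left of [x]. *)
Definition primitive f x : R :=
  if 0 <= x then integral_of f 0 x else - integral_of f x 0.

Lemma integral_of_split f a b x : continuous f -> a <= x <= b ->
  integral_of f a b = integral_of f a x + integral_of f x b.
Proof.
move=> cf /andP[ax xb].
have := @Rintegral_itvB R f (BLeft a) (BRight b) x (continuous_integrable a b cf).
rewrite !bnd_simp => /(_ ax xb); rewrite Rintegral_itv_obnd_cbnd.
  by rewrite /integral_of => <-; rewrite addrC subrK.
apply: (integrableS _ _ _ (continuous_integrable x b cf)) => //.
exact: subset_itv_oc_cc.
Qed.

(** Near any point the oriented integral differs by a constant from an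
    integral with a fixed lower bound, to which the fundamental theorem of
    calculus applies. *)
Lemma primitiveE f a x : continuous f -> a < 0 -> a < x ->
  primitive f x = integral_of f a x - integral_of f a 0.
Proof.
move=> cf a0 ax; rewrite /primitive; case: ifPn => [x0|].
  by rewrite (@integral_of_split f a x 0) ?(ltW a0) ?x0//; lra.
rewrite -ltNge => x0; rewrite (@integral_of_split f a 0 x) ?(ltW ax) ?(ltW x0)//; lra.
Qed.

Lemma primitiveP f : continuous f -> has_derivative (primitive f) f.
Proof.
move=> cf x; pose a := - `|x| - 1.
have a0 : a < 0 by rewrite /a; have := normr_ge0 x; lra.
have ax : a < x by rewrite /a; have := ler_norm (- x); rewrite normrN; lra.
have [dF F'] := @continuous_FTC1_closed R f a x (x + 1) (ltac:(lra))
  (continuous_integrable a (x + 1) cf) ax (cf x).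
have dG : is_derive x (1 : R) (fun y => integral_of f a y - integral_of f a 0) (f x).
  rewrite -[f x]subr0; apply: is_deriveB; apply: DeriveDef => //.
  by rewrite -F' derive1E.
apply: near_eq_is_derive dG; near=> y.
rewrite (@primitiveE f a)//; near: y; exact: lt_nbhsr.
Unshelve. all: by end_near. Qed.

Lemma primitive0 f : primitive f 0 = 0.
Proof. by rewrite /primitive lexx /integral_of set_itv1 Rintegral_set1. Qed.

Lemma integral_primitive f a b : a <= b -> continuous f ->
  integral_of f a b = primitive f b - primitive f a.
Proof. by move=> ab cf; apply: integral_of_derivative => //; exact: primitiveP. Qed.

Lemma eq_integral_of f g a b : f =1 g -> integral_of f a b = integral_of g a b.
Proof. by move=> /funext->. Qed.

Lemma integral_ofD f g a b : continuous f -> continuous g ->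
  integral_of (fun x => f x + g x) a b = integral_of f a b + integral_of g a b.
Proof. by move=> cf cg; apply: RintegralD => //; exact: continuous_integrable. Qed.

Lemma integral_ofB f g a b : continuous f -> continuous g ->
  integral_of (fun x => f x - g x) a b = integral_of f a b - integral_of g a b.
Proof. by move=> cf cg; apply: RintegralB => //; exact: continuous_integrable. Qed.

Lemma integral_ofZ (k : R) f a b : continuous f ->
  integral_of (fun x => k * f x) a b = k * integral_of f a b.
Proof. by move=> cf; apply: RintegralZl => //; exact: continuous_integrable. Qed.

Lemma integral_of_ge0 f a b : (forall x, a <= x <= b -> 0 <= f x) ->
  0 <= integral_of f a b.
Proof. by move=> f0; apply: Rintegral_ge0 => x /=; rewrite in_itv/=; exact: f0. Qed.

Lemma le_integral_of f g a b : continuous f -> continuous g ->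
  (forall x, a <= x <= b -> f x <= g x) -> integral_of f a b <= integral_of g a b.
Proof.
move=> cf cg fg; by apply: le_Rintegral => //; exact: continuous_integrable.
Qed.

Lemma integral_of_cst (k : R) a b : a <= b ->
  integral_of (fun=> k) a b = k * (b - a).
Proof.
move=> ab; have dF : has_derivative (fun x => k * x) (fun=> k).
  apply: has_derivative_eq (has_derivativeZ k (@has_derivative_id R)) => // x.
  by rewrite mulr1.
rewrite (integral_of_derivative ab _ dF) ?mulrBr// => x; exact: cvg_cst.
Qed.

(** A primitive of [f] is monotone with equal values at [a] and [b], hence
    constant in between, and its derivative [f] vanishes there. *)
Lemma integral_of_eq0 f a b : continuous f -> (forall x, 0 <= f x) ->
  integral_of f a b = 0 -> forall x, a < x < b -> f x = 0.
Proof.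
move=> cf f0 If x /andP[ax xb]; have ab : a <= b by rewrite ltW// (lt_trans ax).
have dF := primitiveP cf.
have mF y z : y <= z -> primitive f y <= primitive f z.
  by move=> yz; apply: (has_derivative_ge0_le dF yz) => w _; exact: f0.
move: If; rewrite (integral_primitive ab cf) => /eqP; rewrite subr_eq0 => /eqP Fab.
have d0 : is_derive x (1 : R) (primitive f) 0.
  apply: (@near_eq_is_derive _ _ _ (fun=> primitive f a) (primitive f)); last first.
  near=> y; apply/eqP; rewrite eq_le; apply/andP; split; first apply: mF.
    by apply: ltW; near: y; exact: lt_nbhsr.
  by rewrite -Fab mF//; apply: ltW; near: y; exact: lt_nbhsl.
by case: d0 (dF x) => _ <- [_ <-].
Unshelve. all: by end_near. Qed.

End Integrals.

(** * Odd periodic functions *)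

Definition odd_periodic (R : realType) (L : R) (f : R -> R) : Prop :=
  (forall x, f (- x) = - f x) /\ periodic f (2 * L).

Section Periodic.
Variables (R : realType) (L : R).
Hypothesis L_gt0 : 0 < L.
Implicit Types (f g u : R -> R).

Local Notation I f := (integral_of f (- L) L).

Let NLL : - L <= L. Proof. by have := L_gt0; lra. Qed.

Lemma odd_periodic_at0 f : odd_periodic L f -> f 0 = 0.
Proof. by case=> /(_ 0) + _; rewrite oppr0; lra. Qed.

Lemma odd_periodic_atL f : odd_periodic L f -> f L = 0.
Proof.
case=> fN fT; have := fT (- L); rewrite fN.
by rewrite (_ : - L + 2 * L = L); [lra|ring].
Qed.

Lemma odd_periodicD f g : odd_periodic L f -> odd_periodic L g ->
  odd_periodic L (fun x => f x + g x).
Proof.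
by move=> [fN fT] [gN gT]; split=> x; rewrite ?fN ?gN ?fT ?gT// opprD.
Qed.

Lemma odd_periodicB f g : odd_periodic L f -> odd_periodic L g ->
  odd_periodic L (fun x => f x - g x).
Proof.
by move=> [fN fT] [gN gT]; split=> x; rewrite ?fN ?gN ?fT ?gT// opprD.
Qed.

Lemma odd_periodicZ (k : R) f : odd_periodic L f ->
  odd_periodic L (fun x => k * f x).
Proof. by move=> [fN fT]; split=> x; rewrite ?fN ?fT// mulrN. Qed.

Lemma odd_periodicX n f : odd n -> odd_periodic L f ->
  odd_periodic L (fun x => f x ^+ n).
Proof.
by move=> on [fN fT]; split=> x; rewrite ?fN ?fT// exprNn -signr_odd on mulN1r.
Qed.

Lemma odd_periodic_laplacian f : odd_periodic L f ->
  odd_periodic L (fun x => f (x + 1) - 2 * f x + f (x - 1)).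
Proof.
move=> [fN fT]; split=> x.
  rewrite (_ : - x + 1 = - (x - 1)); last by ring.
  by rewrite (_ : - x - 1 = - (x + 1)) ?fN; ring.
by rewrite [x + 2 * L + 1]addrAC [x + 2 * L - 1]addrAC !fT.
Qed.

Lemma derivative_periodic f f' T : periodic f T -> has_derivative f f' ->
  periodic f' T.
Proof.
move=> fT df x.
have d1 : has_derivative f (fun x => f' (x + T)).
  by apply: has_derivative_eq (has_derivative_shift T df).
by have [_ <-] := df x; have [_ <-] := d1 x.
Qed.

(** As a function of [a] the left-hand side has derivative
    [f (a + 2 * L) - f a], which is zero. *)
Lemma integral_over_period f a : continuous f -> periodic f (2 * L) ->
  integral_of f a (a + 2 * L) = I f.
Proof.
move=> cf fT; have dF := primitiveP cf.
rewrite !integral_primitive//; last by have := L_gt0; lra.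
have := has_derivative0_cst a (- L)
  (@has_derivative_eq _ _ _ _ _ (fun=> erefl) _
    (has_derivativeB (has_derivative_shift (2 * L) dF) dF)) => ->; last first.
  by move=> x; rewrite fT subrr.
by rewrite (_ : - L + 2 * L = L)//; ring.
Qed.

Lemma integral_shift f s : continuous f -> periodic f (2 * L) ->
  I (fun x => f (x + s)) = I f.
Proof.
move=> cf fT; have dF := has_derivative_shift s (primitiveP cf).
rewrite (integral_of_derivative NLL (continuous_fshift cf) dF).
rewrite -(@integral_over_period f (- L + s))// integral_primitive//.
  by rewrite (_ : - L + s + 2 * L = L + s)//; ring.
by have := L_gt0; lra.
Qed.

Lemma integration_by_parts_periodic f g f' g' :
  has_derivative f f' -> has_derivative g g' ->
  continuous f' -> continuous g' -> periodic f (2 * L) -> periodic g (2 * L) ->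
  I (fun x => f' x * g x) = - I (fun x => f x * g' x).
Proof.
move=> df dg cf' cg' fT gT.
have cf := has_derivative_continuous df.
have cg := has_derivative_continuous dg.
apply/eqP; rewrite -subr_eq0 opprK.
rewrite -integral_ofD; [|exact: continuous_fM|exact: continuous_fM].
rewrite (integral_of_derivative NLL _ (has_derivativeM df dg)); last first.
  by apply: continuous_fD; exact: continuous_fM.
have := fT (- L); have := gT (- L).
by rewrite (_ : - L + 2 * L = L); [move=> -> ->; rewrite subrr|ring].
Qed.

Lemma integral_odd f : continuous f -> (forall x, f (- x) = - f x) -> I f = 0.
Proof.
move=> cf fN; have dF := primitiveP cf; rewrite integral_primitive//.
have dFN : has_derivative (fun x => primitive f (- x)) f.
  by apply: has_derivative_eq (has_derivative_opp dF) => // x; rewrite fN opprK.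
have := has_derivative_unique dF dFN 0 L.
by rewrite oppr0; lra.
Qed.

(** Oddness gives [f] mean zero, so its primitive is periodic; subtracting the
    mean of that primitive makes the second primitive periodic too. *)
Lemma odd_periodic_second_primitive f : continuous f -> odd_periodic L f ->
  exists phi phi1, [/\ odd_periodic L phi, has_derivative phi phi1 &
    has_derivative phi1 f].
Proof.
move=> cf [fN fT]; pose m := I (primitive f) / (2 * L).
have dF := primitiveP cf.
have cF := has_derivative_continuous dF.
pose phi1 x := primitive f x - m.
have d1 : has_derivative phi1 f.
  apply: has_derivative_eq (has_derivativeB dF (has_derivative_cst m)) => // x.
  by rewrite subr0.
have c1 := has_derivative_continuous d1.
have dphi := primitiveP c1.
have FN x : primitive f (- x) = primitive f x.
  have dFN : has_derivative (fun x => primitive f (- x)) f.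
    by apply: has_derivative_eq (has_derivative_opp dF) => // y; rewrite fN opprK.
  by have := has_derivative_unique dF dFN 0 x; rewrite oppr0; lra.
have FT x : primitive f (x + 2 * L) = primitive f x.
  have := integral_over_period x cf fT; rewrite (integral_odd cf fN).
  by rewrite integral_primitive//; [lra|have := L_gt0; lra].
have phi1T : periodic phi1 (2 * L) by move=> x; rewrite /phi1 FT.
exists (primitive phi1), phi1; split=> //; split=> x.
  have dN : has_derivative (fun x => - 1 * primitive phi1 (- x)) phi1.
    apply: has_derivative_eq (has_derivativeZ (-1) (has_derivative_opp dphi)) => // y.
    by rewrite mulN1r opprK /phi1 FN.
  have := has_derivative_unique dphi dN 0 x.
  by rewrite oppr0 primitive0; lra.
have := integral_over_period x c1 phi1T; rewrite integral_primitive//; last first.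
  by have := L_gt0; lra.
have cm : continuous (fun _ : R => m) by move=> ?; exact: cvg_cst.
have -> : I phi1 = I (primitive f) - I (fun=> m) by rewrite -integral_ofB.
rewrite integral_of_cst// /m; have L0 : L != 0 by rewrite gt_eqF.
have -> : I (primitive f) / (2 * L) * (L - - L) = I (primitive f).
  by field; rewrite L0.
by rewrite subrr; lra.
Qed.

(** Cauchy-Schwarz on the segment from [x] to [y]: with [s] the slope of the
    chord, integrate [2 * s * u' - s ^+ 2 <= u' ^+ 2]. The segment is at most a
    period long, so the right-hand side is at most the integral of
    [u' ^+ 2] over a period. *)
Lemma holder_half u u' : has_derivative u u' -> continuous u' ->
  periodic u (2 * L) -> forall x y, `|x - y| <= 2 * L ->
  (u x - u y) ^+ 2 <= I (fun x => u' x ^+ 2) * `|x - y|.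
Proof.
move=> du cu' uT x y; wlog xy : x y / x <= y.
  move=> H; case: (leP x y) => [|/ltW] xy; first exact: H.
  by rewrite distrC -[(u x - u y) ^+ 2]sqrrN opprB; exact: H.
rewrite distrC ger0_norm ?subr_ge0// => yx2L.
move: xy; rewrite le_eqVlt => /predU1P[->|xy].
  by rewrite !subrr expr0n mulr0.
pose s := (u y - u x) / (y - x).
have yx0 : 0 < y - x by rewrite subr_gt0.
have cu2 : continuous (fun x => u' x ^+ 2) by exact: continuous_fX.
have h : integral_of (fun z => 2 * s * u' z - s ^+ 2) x y <=
         integral_of (fun z => u' z ^+ 2) x y.
  apply: le_integral_of => //; last first.
    by move=> z _; have := sqr_ge0 (u' z - s); lra.
  apply: continuous_fB; first exact: continuous_fZ.
  by move=> ?; exact: cvg_cst.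
have e : integral_of (fun z => 2 * s * u' z - s ^+ 2) x y =
         (u y - u x) ^+ 2 / (y - x).
  rewrite integral_ofB; [|exact: continuous_fZ|by move=> ?; exact: cvg_cst].
  rewrite integral_ofZ// (integral_of_derivative (ltW xy) cu' du).
  rewrite integral_of_cst ?(ltW xy)// /s; field; lra.
have u'T := derivative_periodic uT du.
have le2 : integral_of (fun z => u' z ^+ 2) x y <= I (fun x => u' x ^+ 2).
  rewrite -(@integral_over_period _ x)//; last by move=> z; rewrite u'T.
  rewrite (@integral_of_split _ _ x (x + 2 * L) y)//; last first.
    by rewrite (ltW xy)/=; lra.
  by rewrite lerDl integral_of_ge0// => z _; exact: sqr_ge0.
rewrite -[(u x - u y) ^+ 2]sqrrN opprB -ler_pdivrMr// -e.
exact: le_trans le2.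
Qed.

(** With [T x = tan (th * (x - mid))], the function
    [u' ^+ 2 - th ^+ 2 * u ^+ 2] plus the derivative of [th * T * u ^+ 2] is the
    square of [u' + th * T * u]; the boundary terms vanish with [u]. As
    [th * (b - a)] is strictly below [pi], the tangent has no pole on [[a, b]]. *)
Lemma wirtinger_interval u u' (a b th : R) : has_derivative u u' ->
  continuous u' -> u a = 0 -> u b = 0 -> a < b -> 0 <= th -> th * (b - a) < pi ->
  th ^+ 2 * integral_of (fun x => u x ^+ 2) a b <=
  integral_of (fun x => u' x ^+ 2) a b.
Proof.
move=> du cu' ua ub ab th0 thpi.
have cu := has_derivative_continuous du.
have cu2 : continuous (fun x => u x ^+ 2) by exact: continuous_fX.
have cu'2 : continuous (fun x => u' x ^+ 2) by exact: continuous_fX.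
pose mid := (a + b) / 2.
rewrite -subr_ge0 -integral_ofZ// -integral_ofB//; last exact: continuous_fZ.
pose W x := primitive (fun x => u' x ^+ 2 - th ^+ 2 * u x ^+ 2) x +
  th * (tan (th * (x - mid)) * u x ^+ 2).
have cf : continuous (fun x => u' x ^+ 2 - th ^+ 2 * u x ^+ 2).
  by apply: continuous_fB => //; exact: continuous_fZ.
have cosx x : a <= x <= b -> 0 < cos (th * (x - mid)).
  move=> /andP[ax xb]; apply: cos_gt0_pihalf.
  have h1 : th * (a - mid) <= th * (x - mid) by rewrite ler_wpM2l//; lra.
  have h2 : th * (x - mid) <= th * (b - mid) by rewrite ler_wpM2l//; lra.
  have e1 : th * (a - mid) = - (th * (b - a) / 2) by rewrite /mid; field.
  have e2 : th * (b - mid) = th * (b - a) / 2 by rewrite /mid; field.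
  by apply/andP; split; lra.
have dW x : a <= x <= b -> is_derive x (1 : R) W
    ((u' x + th * tan (th * (x - mid)) * u x) ^+ 2).
  move=> xab; have c0 := cosx _ xab.
  have dtan : is_derive x (1 : R) (fun x => tan (th * (x - mid)))
      ((cos (th * (x - mid))) ^- 2 * th).
    have dl : is_derive x (1 : R) (fun x => th * (x - mid)) th.
      have := has_derivativeZ th (has_derivativeB (@has_derivative_id R)
        (has_derivative_cst mid)) x.
      by rewrite subr0 mulr1.
    apply: (@is_derive1_comp _ tan (fun x => th * (x - mid)) x _ _ _ dl).
    by apply: is_derive_tan; rewrite gt_eqF.
  have du2 : is_derive x (1 : R) (fun x => u x ^+ 2) (u' x * u x + u x * u' x).
    have := has_derivativeM du du x.
    by rewrite (_ : (fun x => u x * u x) = (fun x => u x ^+ 2)).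
  have d2 := @is_deriveM _ _ _ _ x 1 _ _ dtan du2.
  have d3 := @is_deriveZ _ _ _ _ th x 1 _ d2.
  have d4 := @is_deriveD _ _ _ _ _ x 1 _ _ (primitiveP cf x) d3.
  refine (is_derive_eq d4 _).
  rewrite /GRing.scale/=.
  have -> : (cos (th * (x - mid))) ^- 2 = 1 + tan (th * (x - mid)) ^+ 2.
    rewrite /tan expr_div_n -[X in X ^- 2 = _]mul1r.
    have := cos2Dsin2 (th * (x - mid)).
    move: c0; set C := cos _; set S := sin _ => C0 CS.
    have C0' : C ^+ 2 != 0 by rewrite expf_neq0// gt_eqF.
    by rewrite mul1r -[LHS]mul1r -CS mulrDl divff// CS.
  by ring.
have W' : W a <= W b.
  rewrite -subr_ge0.
  have dWo x : x \in `]a, b[%R -> is_derive x (1 : R) W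
      ((u' x + th * tan (th * (x - mid)) * u x) ^+ 2).
    by rewrite in_itv/= => /andP[ax xb]; apply: dW; rewrite !ltW.
  have cW : {within `[a, b], continuous W}.
    apply: derivable_within_continuous => x; rewrite in_itv/= => xab.
    by case: (dW x xab).
  have [x _ ->] := MVT ab dWo cW.
  by rewrite mulr_ge0 ?sqr_ge0// subr_ge0 ltW.
move: W'; rewrite /W ua ub expr0n/= !mulr0 !addr0.
by rewrite integral_primitive ?subr_ge0// ltW.
Qed.

Lemma wirtinger u u' (th : R) : has_derivative u u' -> continuous u' ->
  odd_periodic L u -> 0 <= th -> th * L < pi ->
  th ^+ 2 * I (fun x => u x ^+ 2) <= I (fun x => u' x ^+ 2).
Proof.
move=> du cu' uOP th0 thpi.
have cu := has_derivative_continuous du.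
have u0 := odd_periodic_at0 uOP; have uL := odd_periodic_atL uOP.
have uNL : u (- L) = 0 by rewrite uOP.1 uL oppr0.
have N0L : - L <= 0 <= L by have := L_gt0; lra.
rewrite !(@integral_of_split _ _ (- L) L 0)//; [|exact: continuous_fX..].
rewrite mulrDr lerD//.
  by apply: wirtinger_interval => //; [have := L_gt0; lra|rewrite sub0r opprK].
by apply: wirtinger_interval => //; rewrite subr0.
Qed.

(** The same [y] serves all periodic functions, so that bounds on one period
    extend to the line uniformly along a sequence. *)
Lemma reduce_mod_period x : exists2 y, - L <= y <= L &
  forall f, periodic f (2 * L) -> f x = f y.
Proof.
pose k : int := Num.floor ((x + L) / (2 * L)).
exists (x - k%:~R * (2 * L)).
  have /andP[] := floor_itv ((x + L) / (2 * L)).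
  by rewrite -/k ler_pdivlMr ?ltr_pdivrMr ?mulr_gt0//; lra.
move=> f fT.
have fn n z : f (z + n%:R * (2 * L)) = f z by rewrite mulr_natl periodicn.
case: k => n.
  by rewrite -[x in LHS](subrK (n%:R * (2 * L))) fn.
by rewrite NegzE mulrNz mulNr opprK fn.
Qed.

End Periodic.

(** * Compactness of uniformly Hoelder functions *)

Section UniformLimits.
Variables (R : realType) (F : set_system nat).
Hypothesis F_ultra : UltraFilter F.

(** Working along one ultrafilter replaces the diagonal extraction of
    subsequences: every bounded sequence of reals converges along it. *)
Lemma ultra_bounded_cvg (v : nat -> R) (b : R) : (forall n, `|v n| <= b) ->
  exists l : R, v n @[n --> F] --> l.
Proof.
move=> vb.
have Fv : F [set n | `[- b, b]%classic (v n)].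
  by apply: filterE => n /=; rewrite in_itv/= -ler_norml.
have [l [_ cl]] := @segment_compact R (- b) b (v @ F) _ Fv.
exists l; apply/cvgrPdist_le => e e0.
have [//|FC] := in_ultra_setVsetC [set n | `|l - v n| <= e] F_ultra.
pose C := v @` ~` [set n | `|l - v n| <= e].
have vFC : F [set n | C (v n)].
  by apply: (filterS _ FC) => n nC; exists n.
have [_ [[n nC <-] /= ln]] := cl C _ vFC (nbhsx_ballx l e e0).
by case: nC; rewrite /= ltW.
Qed.

Definition uniform_cvg_on (D : set R) (f_ : nat -> R -> R) (f : R -> R) :=
  forall e : R, 0 < e -> \forall n \near F, forall x, D x -> `|f_ n x - f x| <= e.

Lemma uniform_cvgX D (u_ : nat -> R -> R) u (b : R) k :
  (forall n x, D x -> `|u_ n x| <= b) -> (forall x, D x -> `|u x| <= b) ->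
  uniform_cvg_on D u_ u ->
  uniform_cvg_on D (fun n x => u_ n x ^+ k) (fun x => u x ^+ k).
Proof.
move=> ub vb uu.
have [[x0 Dx0]|nD] := pselect (exists x, D x); last first.
  by move=> e e0; apply: filterE => n x Dx; case: nD; exists x.
have b0 : 0 <= b by apply: le_trans (vb _ Dx0).
elim: k => [|k ih] e e0.
  by apply: filterE => n x _; rewrite !expr0 subrr normr0 ltW.
have B0 : 0 < b + 1 by lra.
have K0 : 0 < b ^+ k + 1 by have := exprn_ge0 k b0; lra.
have e1 : 0 < e / 2 / (b + 1) by rewrite !divr_gt0.
have e2 : 0 < e / 2 / (b ^+ k + 1) by rewrite !divr_gt0.
have h1 := ih _ e1; have h2 := uu _ e2.
near=> n => x Dx.
have -> : u_ n x ^+ k.+1 - u x ^+ k.+1 =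
    u_ n x * (u_ n x ^+ k - u x ^+ k) + u x ^+ k * (u_ n x - u x).
  by rewrite !exprS; ring.
have -> : e = (b + 1) * (e / 2 / (b + 1)) + (b ^+ k + 1) * (e / 2 / (b ^+ k + 1)).
  by field; rewrite !gt_eqF.
apply: le_trans (ler_normD _ _) _; rewrite !normrM; apply: lerD.
  apply: ler_pM => //; first by rewrite (le_trans (ub n x Dx))//; lra.
  by move: x Dx; near: n.
apply: ler_pM => //; last by move: x Dx; near: n.
rewrite normrX (@le_trans _ _ (b ^+ k))//; last by lra.
by rewrite lerXn2r ?nnegrE// vb.
Unshelve. all: by end_near. Qed.

Lemma integral_uniform_cvg (a b : R) (f_ : nat -> R -> R) f psi :
  a <= b ->
  (forall n, continuous (f_ n)) -> continuous f -> continuous psi ->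
  uniform_cvg_on `[a, b] f_ f ->
  integral_of (fun x => f_ n x * psi x) a b @[n --> F] -->
  integral_of (fun x => f x * psi x) a b.
Proof.
move=> ab cf_ cf cpsi ff.
have cn : continuous (fun x => `|psi x|).
  by move=> x; apply: cvg_norm; exact: cpsi.
have [z _ zmax] := EVT_max ab (continuous_subspaceT cn).
set B := `|psi z| in zmax.
have B0 : 0 <= B by exact: normr_ge0.
apply/cvgrPdist_le => e e0.
(* The added ones keep the denominator positive when [psi] is zero or [a = b]. *)
have D0 : 0 < (B + 1) * (b - a + 1) by rewrite mulr_gt0//; lra.
have e1 : 0 < e / ((B + 1) * (b - a + 1)) by rewrite divr_gt0.
have h := ff _ e1.
set d := e / _ in h e1.
near=> n; rewrite distrC -integral_ofB; [|exact: continuous_fM..].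
have hn : forall x, `[a, b]%classic x -> `|f_ n x - f x| <= d by near: n.
have cd : continuous (fun x => f_ n x * psi x - f x * psi x).
  by apply: continuous_fB; exact: continuous_fM.
have hd x : a <= x <= b -> `|f_ n x * psi x - f x * psi x| <= d * (B + 1).
  move=> xab; rewrite -mulrBl normrM; apply: ler_pM => //; last first.
    by have := zmax x; rewrite in_itv/= => /(_ xab); lra.
  by apply: hn; rewrite /= in_itv.
have ed : d * (B + 1) * (b - a) <= e.
  have -> : e = d * (B + 1) * (b - a + 1).
    by rewrite /d; field; rewrite !gt_eqF//; lra.
  have dB : 0 <= d * (B + 1) by apply: mulr_ge0; [exact: ltW|lra].
  by rewrite ler_wpM2l//; lra.
have cc (k : R) : continuous (fun _ : R => k) by move=> ?; exact: cvg_cst.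
rewrite ler_norml; apply/andP; split.
  apply: (@le_trans _ _ (integral_of (fun=> - (d * (B + 1))) a b)).
    by rewrite integral_of_cst//; lra.
  by apply: le_integral_of => // x /hd; rewrite ler_norml => /andP[].
apply: le_trans ed; rewrite -integral_of_cst//.
by apply: le_integral_of => // x /hd; rewrite ler_norml => /andP[].
Unshelve. all: by end_near. Qed.

End UniformLimits.

Section Compactness.
Variables (R : realType) (L K : R).
Hypothesis L_gt0 : 0 < L.

Definition holder_bound (u : R -> R) : Prop :=
  forall x y, `|x - y| <= 2 * L -> (u x - u y) ^+ 2 <= K * `|x - y|.

Lemma holder_near (x e : R) : 0 <= K -> 0 < e -> \forall y \near x,
  forall u, holder_bound u -> `|u x - u y| <= e.
Proof.
move=> K0 e0.
pose d := Num.min (2 * L) (e ^+ 2 / (K + 1)).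
have d0 : 0 < d by rewrite lt_min divr_gt0 ?exprn_gt0 ?mulr_gt0//; lra.
near=> y => v vK.
have xyd : `|x - y| <= d.
  near: y; have /cvgrPdist_le : (fun y : R => y) @ x --> x by exact: cvg_id.
  exact.
have [xy1 xy2] : `|x - y| <= 2 * L /\ `|x - y| <= e ^+ 2 / (K + 1).
  by move: xyd; rewrite /d le_min => /andP.
rewrite -(@ler_pXn2r _ 2)// ?nnegrE ?(ltW e0)// -normrX ger0_norm ?sqr_ge0//.
apply: le_trans (vK _ _ xy1) _.
apply: (@le_trans _ _ ((K + 1) * `|x - y|)).
  by rewrite ler_wpM2r//; lra.
by rewrite mulrC -ler_pdivlMr//; lra.
Unshelve. all: by end_near. Qed.

Lemma holder_continuous u : 0 <= K -> holder_bound u -> continuous u.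
Proof.
move=> K0 uK x; apply/cvgrPdist_le => e e0.
by apply: filterS (@holder_near x e K0 e0) => y; exact.
Qed.

Lemma holder_bounded u : 0 <= K -> odd_periodic L u -> holder_bound u ->
  forall x, `|u x| <= K * L + 1.
Proof.
move=> K0 uOP uK x.
have [y yL ->] := reduce_mod_period L_gt0 x; last exact: uOP.2.
have yn : `|y| <= L by rewrite ler_norml.
have := uK y 0; rewrite !subr0 (odd_periodic_at0 uOP) subr0 => h.
have {}h : u y ^+ 2 <= K * `|y| by apply: h; have := L_gt0; lra.
have h2 : K * `|y| <= K * L by rewrite ler_wpM2l.
have e : `|u y| ^+ 2 = u y ^+ 2 by rewrite -normrX ger0_norm// sqr_ge0.
have KL : 0 <= K * L by rewrite mulr_ge0// ltW.
by have := sqr_ge0 (`|u y| - 1); lra.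
Qed.

(** Arzela-Ascoli: pointwise limits along the ultrafilter inherit the Hoelder
    bound, and a neighbourhood of [x] on which all the functions vary by at most
    [e / 3] makes the convergence locally uniform; compactness of a period
    concludes. *)
Lemma holder_compact (u_ : nat -> R -> R) (F : set_system nat) :
  UltraFilter F -> 0 <= K ->
  (forall n, odd_periodic L (u_ n)) -> (forall n, holder_bound (u_ n)) ->
  exists u, [/\ odd_periodic L u, holder_bound u &
    uniform_cvg_on F `[- L, L] u_ u].
Proof.
move=> FU K0 uOP uK.
have [u cu] := choice (fun x => ultra_bounded_cvg FU
  (fun n => holder_bounded K0 (uOP n) (uK n) x)).
have lim_eq (v : nat -> R) (l l' : R) : v n @[n --> F] --> l -> v n @[n --> F] --> l' -> l = l'.
  by move=> vl vl'; exact: (@cvg_unique _ (@Rhausdorff R) (v @ F)).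
have uholder : holder_bound u.
  move=> x y xy.
  have c : (u_ n x - u_ n y) ^+ 2 @[n --> F] --> (u x - u y) ^+ 2.
    apply: cvgM; apply: cvgB; exact: cu.
  by apply: (cvgr_to_le c); apply: filterE => n; exact: uK.
exists u; split=> //.
- split=> x.
    apply: (lim_eq _ _ _ (cu (- x))).
    have -> : (fun n => u_ n (- x)) = (fun n => - u_ n x).
      by apply/funext => n; rewrite (uOP n).1.
    by apply: cvgN; exact: cu.
  apply: (lim_eq _ _ _ (cu (x + 2 * L))).
  have -> : (fun n => u_ n (x + 2 * L)) = (fun n => u_ n x).
    by apply/funext => n; rewrite (uOP n).2.
  exact: cu.
move=> e e0; have e3 : 0 < e / 3 by lra.
have /compact_near_coveringP cov := @segment_compact R (- L) L.
apply: (cov nat F (fun n x => `|u_ n x - u x| <= e)) => x _.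
have h1 := @holder_near x (e / 3) K0 e3.
have /cvgrPdist_le/(_ _ e3) h2 := cu x.
near=> y n => /=.
have hy : forall v, holder_bound v -> `|v x - v y| <= e / 3 by near: y.
have hn : `|u x - u_ n x| <= e / 3 by near: n.
have := hy _ uholder; have := hy _ (uK n); move: hn.
by rewrite !ler_norml; lra.
Unshelve. all: by end_near. Qed.

End Compactness.

(** * The energy and its coercivity *)

Ltac solve_continuous :=
  lazymatch goal with
  | |- continuous (fun x => @?f x - @?g x) =>
      apply: (@continuous_fB _ f g); solve_continuous
  | |- continuous (fun x => @?f x + @?g x) =>
      apply: (@continuous_fD _ f g); solve_continuous
  | |- continuous (fun x => @?f x * @?g x) =>
      apply: (@continuous_fM _ f g); solve_continuous
  | |- continuous (fun x => @?f x ^+ ?n) =>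
      apply: (@continuous_fX _ n f); solve_continuous
  | |- continuous (fun x => ?f (x + ?s)) =>
      apply: (@continuous_fshift _ s f); solve_continuous
  | _ => first [ assumption | by move=> ?; exact: cvg_cst ]
  end.

Section Energy.
Variables (R : realType) (L kappa c omega0 : R).
Hypotheses (L_gt0 : 0 < L) (kappa_gt0 : 0 < kappa) (c_neq0 : c != 0).
Implicit Types (u v phi : R -> R).

Local Notation I f := (integral_of f (- L) L).

(** Admissible functions of the variational problem. They are only of
    class C1: the maximizer is a uniform limit of such functions, and its
    smoothness is recovered from the equation. *)
Definition trial u u' : Prop :=
  [/\ odd_periodic L u, has_derivative u u' & continuous u'].

(** The symmetric bilinear form of the linear part of the wave equation, written
    with first derivatives and differences only. *)
Definition energy u u' v v' : R :=
  I (fun x => c ^+ 2 * (u' x * v' x) + omega0 ^+ 2 * (u x * v x) -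
              kappa * ((u (x + 1) - u x) * (v (x + 1) - v x))).

(** In this notation the wave equation reads [linear_part Q Q'' = a * Q ^+ p]. *)
Definition linear_part phi phi'' x : R :=
  - c ^+ 2 * phi'' x + omega0 ^+ 2 * phi x +
  kappa * (phi (x + 1) - 2 * phi x + phi (x - 1)).

Lemma trial_continuous u u' : trial u u' -> continuous u.
Proof. by case=> _ /has_derivative_continuous. Qed.

Lemma trialD u u' v v' : trial u u' -> trial v v' ->
  trial (fun x => u x + v x) (fun x => u' x + v' x).
Proof.
move=> [uOP du cu'] [vOP dv cv']; split; first exact: odd_periodicD.
  exact: has_derivativeD.
exact: continuous_fD.
Qed.

Lemma trialZ k u u' : trial u u' -> trial (fun x => k * u x) (fun x => k * u' x).
Proof.
move=> [uOP du cu']; split; first exact: odd_periodicZ.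
  exact: has_derivativeZ.
exact: continuous_fZ.
Qed.

Lemma energyZ k u u' : trial u u' ->
  energy (fun x => k * u x) (fun x => k * u' x) (fun x => k * u x) (fun x => k * u' x) =
  k ^+ 2 * energy u u' u u'.
Proof.
move=> tu; have cu := trial_continuous tu; case: tu => _ _ cu'.
rewrite /energy -integral_ofZ; last by solve_continuous.
by apply: eq_integral_of => x; ring.
Qed.

Lemma energyD t u u' v v' : trial u u' -> trial v v' ->
  energy (fun x => u x + t * v x) (fun x => u' x + t * v' x)
         (fun x => u x + t * v x) (fun x => u' x + t * v' x) =
  energy u u' u u' + 2 * t * energy u u' v v' + t ^+ 2 * energy v v' v v'.
Proof.
move=> tu tv; have cu := trial_continuous tu; have cv := trial_continuous tv.
case: tu => _ _ cu'; case: tv => _ _ cv'.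
rewrite /energy -!integral_ofZ -?integral_ofD; try by solve_continuous.
by apply: eq_integral_of => x; ring.
Qed.

(** Integration by parts moves the derivative to [phi], and translation
    invariance moves the difference: all that is left of [u] is its value. This
    is what survives in a uniform limit. *)
Lemma energy_linear_part u u' phi phi' phi'' : trial u u' -> trial phi phi' ->
  has_derivative phi' phi'' -> continuous phi'' ->
  energy u u' phi phi' = I (fun x => u x * linear_part phi phi'' x).
Proof.
move=> tu tp dphi' cphi''.
have cu := trial_continuous tu; have cphi := trial_continuous tp.
case: tu => [[_ uT] du cu']; case: tp => [[_ pT] dp cp'].
have p'T := derivative_periodic pT dp.
have parts : I (fun x => u' x * phi' x) = - I (fun x => u x * phi'' x).
  exact: integration_by_parts_periodic.
have sh1 : I (fun x => u (x + 1) * phi (x + 1)) = I (fun x => u x * phi x).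
  apply: (@integral_shift _ _ L_gt0 (fun x => u x * phi x)); first by solve_continuous.
  by move=> x; rewrite uT pT.
have sh2 : I (fun x => u (x + 1) * phi x) = I (fun x => u x * phi (x - 1)).
  rewrite -(@integral_shift _ _ L_gt0 (fun x => u x * phi (x - 1)) 1).
  - by apply: eq_integral_of => x; rewrite addrK.
  - by solve_continuous.
  - by move=> x; rewrite uT [x + 2 * L - 1]addrAC pT.
have e1 : energy u u' phi phi' =
  c ^+ 2 * I (fun x => u' x * phi' x) + omega0 ^+ 2 * I (fun x => u x * phi x)
  - kappa * (I (fun x => u (x + 1) * phi (x + 1)) - I (fun x => u (x + 1) * phi x)
             - I (fun x => u x * phi (x + 1)) + I (fun x => u x * phi x)).
  rewrite /energy -!(integral_ofB, integral_ofD, integral_ofZ); try by solve_continuous.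
  by apply: eq_integral_of => x; ring.
have e2 : I (fun x => u x * linear_part phi phi'' x) =
  - c ^+ 2 * I (fun x => u x * phi'' x) + omega0 ^+ 2 * I (fun x => u x * phi x)
  + kappa * (I (fun x => u x * phi (x + 1)) - 2 * I (fun x => u x * phi x)
     + I (fun x => u x * phi (x - 1))).
  rewrite /linear_part -!(integral_ofB, integral_ofD, integral_ofZ); try by solve_continuous.
  by apply: eq_integral_of => x; ring.
by rewrite e1 e2 parts sh1 sh2; ring.
Qed.

Hypothesis cond : 4 * kappa <= omega0 ^+ 2 \/
  (omega0 ^+ 2 < 4 * kappa /\
   poincare_const L * (4 * kappa - omega0 ^+ 2) < c ^+ 2).

(** The difference operator is bounded through
    [(u (x + 1) - u x) ^+ 2 <= 2 * (u (x + 1) ^+ 2 + u x ^+ 2)], and the two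
    squares have the same integral. *)
Lemma energy_lower_bound u u' : trial u u' ->
  c ^+ 2 * I (fun x => u' x ^+ 2) - (4 * kappa - omega0 ^+ 2) * I (fun x => u x ^+ 2)
  <= energy u u' u u'.
Proof.
move=> tu; have cu := trial_continuous tu; case: tu => [[_ uT] du cu'].
have sh : I (fun x => u (x + 1) ^+ 2) = I (fun x => u x ^+ 2).
  apply: (@integral_shift _ _ L_gt0 (fun x => u x ^+ 2)); first by solve_continuous.
  by move=> x; rewrite uT.
have -> : c ^+ 2 * I (fun x => u' x ^+ 2) -
    (4 * kappa - omega0 ^+ 2) * I (fun x => u x ^+ 2) =
  I (fun x => c ^+ 2 * u' x ^+ 2 + omega0 ^+ 2 * u x ^+ 2
     - 2 * kappa * (u (x + 1) ^+ 2 + u x ^+ 2)).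
  have -> : (4 * kappa - omega0 ^+ 2) * I (fun x => u x ^+ 2) =
    2 * kappa * (I (fun x => u (x + 1) ^+ 2) + I (fun x => u x ^+ 2))
    - omega0 ^+ 2 * I (fun x => u x ^+ 2) by rewrite sh; ring.
  rewrite -!(integral_ofB, integral_ofD, integral_ofZ); try by solve_continuous.
  by apply: eq_integral_of => x; ring.
apply: le_integral_of; try by solve_continuous.
move=> x _; have := mulr_ge0 (ltW kappa_gt0) (sqr_ge0 (u (x + 1) + u x)).
lra.
Qed.

(** When [omega0 ^+ 2 < 4 * kappa] the negative term is absorbed by the Wirtinger
    inequality, whose constant [th ^+ 2] is any number below [pi ^+ 2 / L ^+ 2].
    Here [s < 1] is the ratio of the two sides of the velocity condition, and
    [th = t * pi / L] with [s < t ^+ 2 < 1]. *)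
Lemma energy_coercive : exists2 delta, 0 < delta &
  forall u u', trial u u' -> delta * I (fun x => u' x ^+ 2) <= energy u u' u u'.
Proof.
have c2 : 0 < c ^+ 2 by rewrite exprn_even_gt0.
case: cond => [ge4|[lt4 ltc]].
  exists (c ^+ 2) => // u u' tu; apply: le_trans (energy_lower_bound tu).
  rewrite lerBrDl gerDr mulr_le0_ge0//; first by lra.
  by apply: integral_of_ge0 => x _; exact: sqr_ge0.
set r := 4 * kappa - omega0 ^+ 2 in ltc.
have r0 : 0 < r by rewrite /r; lra.
have pi0 := pi_gt0 R.
pose s := L ^+ 2 / pi ^+ 2 * r / c ^+ 2.
have s1 : s < 1 by rewrite /s ltr_pdivrMr// mul1r.
have s0 : 0 < s by rewrite /s divr_gt0// mulr_gt0// divr_gt0// exprn_gt0.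
pose t := (1 + s) / 2.
have t0 : 0 < t by rewrite /t; lra.
have t1 : t < 1 by rewrite /t; lra.
have st : s < t ^+ 2.
  rewrite -subr_gt0.
  have -> : t ^+ 2 - s = (1 - s) ^+ 2 / 4 by rewrite /t; field.
  by rewrite divr_gt0// exprn_gt0//; lra.
pose th := t * pi / L.
have th0 : 0 < th by rewrite /th divr_gt0// mulr_gt0.
have thL : th * L < pi.
  by rewrite /th divfK ?gt_eqF// -[X in _ < X]mul1r ltr_pM2r//.
have rE : r = c ^+ 2 * s / t ^+ 2 * th ^+ 2.
  have gen (q v : R) : q != 0 -> v != 0 ->
      r = c ^+ 2 * (L ^+ 2 / q ^+ 2 * r / c ^+ 2) / v ^+ 2 * (v * q / L) ^+ 2.
    by move=> q0 v0; field; rewrite q0 v0 c_neq0 gt_eqF.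
  by apply: gen; rewrite gt_eqF.
exists (c ^+ 2 * (1 - s / t ^+ 2)).
  by rewrite mulr_gt0// subr_gt0 ltr_pdivrMr ?mul1r// exprn_gt0.
move=> u u' tu; apply: le_trans (energy_lower_bound tu).
have [uOP du cu'] := tu.
have w := wirtinger L_gt0 du cu' uOP (ltW th0) thL.
rewrite -/r rE -mulrA.
have k0 : 0 <= c ^+ 2 * s / t ^+ 2.
  by rewrite divr_ge0 ?sqr_ge0// mulr_ge0 ?sqr_ge0// ltW.
have := ler_wpM2l k0 w; lra.
Qed.

End Energy.

(** * Maximizing the nonlinear term at bounded energy *)

Lemma ge0_expr_tangent (R : realDomainType) (m : nat) (a b : R) :
  0 <= a -> 0 <= b ->
  a ^+ m.+1 + m.+1%:R * a ^+ m * (b - a) <= b ^+ m.+1.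
Proof.
move=> a0 b0; elim: m => [|m ih]; first by rewrite !expr1 expr0; lra.
rewrite [b ^+ _]exprS; apply: le_trans (ler_wpM2l b0 ih).
rewrite -subr_ge0.
have -> : b * (a ^+ m.+1 + m.+1%:R * a ^+ m * (b - a)) -
   (a ^+ m.+2 + m.+2%:R * a ^+ m.+1 * (b - a)) =
   m.+1%:R * a ^+ m * (b - a) ^+ 2.
  by rewrite !exprS -[m.+2]addn1 natrD; ring.
by rewrite mulr_ge0 ?sqr_ge0// mulr_ge0// exprn_ge0.
Qed.

(** Convexity of even powers, from that of [y ^+ m.+1] at [y = x ^+ 2]. *)
Lemma even_expr_tangent (R : realDomainType) (m : nat) (x h : R) :
  x ^+ (2 * m.+1) + (2 * m.+1)%:R * (x ^+ (2 * m).+1 * h) <=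
  (x + h) ^+ (2 * m.+1).
Proof.
rewrite !exprM; apply: le_trans (ge0_expr_tangent m (sqr_ge0 x) (sqr_ge0 _)).
rewrite lerD2l exprS exprM natrM.
have -> : 2%:R * m.+1%:R * (x * (x ^+ 2) ^+ m * h) =
  m.+1%:R * (x ^+ 2) ^+ m * (2 * x * h) by ring.
apply: ler_wpM2l; first by rewrite mulr_ge0// exprn_ge0// sqr_ge0.
by have := sqr_ge0 h; lra.
Qed.

Section Maximizer.
Variables (R : realType) (L kappa c omega0 delta : R) (m : nat).
Hypotheses (L_gt0 : 0 < L) (delta_gt0 : 0 < delta).
Local Notation I f := (integral_of f (- L) L).
Local Notation trial := (trial L).
Local Notation energy := (energy L kappa c omega0).
Local Notation B := (linear_part kappa c omega0).
Local Notation J u := (I (fun x => u x ^+ (2 * m.+1))).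
Implicit Types u phi : R -> R.

Hypothesis coercive : forall u u', trial u u' ->
  delta * I (fun x => u' x ^+ 2) <= energy u u' u u'.

Let NLL : - L <= L. Proof. by have := L_gt0; lra. Qed.

Lemma gradient_ge0 (u' : R -> R) : 0 <= I (fun x => u' x ^+ 2).
Proof. by apply: integral_of_ge0 => x _; exact: sqr_ge0. Qed.

Lemma energy_ge0 u u' : trial u u' -> 0 <= energy u u' u u'.
Proof.
by move=> /coercive; apply: le_trans; rewrite mulr_ge0 ?gradient_ge0// ltW.
Qed.

Lemma J_ge0 u : 0 <= J u.
Proof. by apply: integral_of_ge0 => x _; rewrite exprM exprn_ge0// sqr_ge0. Qed.

Lemma trial_holder u u' (e : R) : trial u u' -> energy u u' u u' <= e ->
  holder_bound L (e / delta) u.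
Proof.
move=> tu ue x y xy; have [[_ uT] du cu'] := tu.
apply: le_trans (holder_half L_gt0 du cu' uT xy) _.
rewrite ler_wpM2r// ler_pdivlMr// mulrC.
exact: le_trans (coercive tu) ue.
Qed.

Lemma J_bounded u u' : trial u u' -> energy u u' u u' <= 1 ->
  J u <= (delta^-1 * L + 1) ^+ (2 * m.+1) * (L - - L).
Proof.
move=> tu u1; have cu := trial_continuous tu; have [uOP _ _] := tu.
rewrite -integral_of_cst//; apply: le_integral_of => //.
- by solve_continuous.
- by move=> ?; exact: cvg_cst.
move=> x _; have K0 : 0 <= delta^-1 by rewrite invr_ge0 ltW.
have uK := trial_holder tu u1; rewrite div1r in uK.
have ux := holder_bounded L_gt0 K0 uOP uK x.
have -> : u x ^+ (2 * m.+1) = `|u x| ^+ (2 * m.+1).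
  by rewrite !exprM -normrX ger0_norm// sqr_ge0.
by rewrite lerXn2r// nnegrE (le_trans _ ux).
Qed.

Lemma energy0_trivial u u' : trial u u' -> energy u u' u u' <= 0 ->
  forall x, u x = 0.
Proof.
move=> tu u0 x; have [uOP _ _] := tu.
have [y yL ->] := reduce_mod_period L_gt0 x; last exact: uOP.2.
have yn : `|y| <= L by rewrite ler_norml.
have := trial_holder tu u0 (x := y) (y := 0).
rewrite !subr0 (odd_periodic_at0 uOP) subr0 !mul0r => h.
have {}h : u y ^+ 2 <= 0 by apply: h; have := L_gt0; lra.
by apply/eqP; rewrite -sqrf_eq0 eq_le h sqr_ge0.
Qed.

Lemma JZ (k : R) u : continuous u -> J (fun x => k * u x) = k ^+ (2 * m.+1) * J u.
Proof.
move=> cu; rewrite -integral_ofZ; last by solve_continuous.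
by apply: eq_integral_of => x; rewrite exprMn.
Qed.

Lemma J_gt0 u : continuous u -> (exists2 x, - L < x < L & u x != 0) -> 0 < J u.
Proof.
move=> cu [x xL ux]; rewrite lt_neqAle J_ge0 andbT eq_sym.
apply: contra ux => /eqP Ju0.
have cJ : continuous (fun x => u x ^+ (2 * m.+1)) by solve_continuous.
have J0 y : 0 <= u y ^+ (2 * m.+1) by rewrite exprM exprn_ge0// sqr_ge0.
by have /eqP := integral_of_eq0 cJ J0 Ju0 xL; rewrite expf_eq0 => /andP[].
Qed.

(** The sine of period [2 * L]. *)
Lemma exists_trial : exists u u', trial u u' /\ exists2 x, - L < x < L & u x != 0.
Proof.
pose k : R := pi / L.
have dlin : has_derivative (fun x => k * x) (fun=> k).
  by apply: has_derivative_eq (has_derivativeZ k (@has_derivative_id R)) => // x; rewrite mulr1.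
have dsin : has_derivative (@sin R) cos by move=> x; exact: is_derive_sin.
have L0 : L != 0 by rewrite gt_eqF.
exists (fun x => sin (k * x)), (fun x => cos (k * x) * k); split; last first.
  exists (L / 2); first by have := L_gt0; lra.
  have -> : k * (L / 2) = pi / 2 by rewrite /k mulrA divfK.
  by rewrite sin_pihalf oner_neq0.
split.
- split=> x; first by rewrite mulrN sinN.
  have -> : k * (x + 2 * L) = k * x + pi *+ 2.
    by rewrite mulrDr mulrCA /k divfK// mulr_natl.
  by rewrite sinD2pi.
- exact: has_derivative_comp dsin dlin.
- move=> x; apply: cvgM; last exact: cvg_cst.
  apply: (@continuous_comp _ _ _ (fun x => k * x) cos).
    exact: has_derivative_continuous dlin x.
  exact: continuous_cos.
Qed.

Definition energy_ball_values : set R :=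
  [set r | exists u u', [/\ trial u u', energy u u' u u' <= 1 & r = J u]].

(** The best constant in the homogeneous inequality [le_sharp_const]. *)
Definition sharp_const : R := sup energy_ball_values.

Lemma energy_ball_values_has_sup : has_sup energy_ball_values.
Proof.
split; last first.
  exists ((delta^-1 * L + 1) ^+ (2 * m.+1) * (L - - L)) => _ [u [u' [tu u1 ->]]].
  exact: J_bounded tu u1.
have [u [u' [tu _]]] := exists_trial.
exists (J (fun x => 0 * u x)), (fun x => 0 * u x), (fun x => 0 * u' x).
split=> //; first exact: trialZ.
by rewrite energyZ// expr0n mul0r.
Qed.

Lemma le_sharp_const1 u u' : trial u u' -> energy u u' u u' <= 1 ->
  J u <= sharp_const.
Proof.
move=> tu u1; apply: sup_upper_bound; first exact: energy_ball_values_has_sup.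
by exists u, u'.
Qed.

Lemma sharp_const_gt0 : 0 < sharp_const.
Proof.
have [u [u' [tu ux]]] := exists_trial.
have cu := trial_continuous tu.
have E0 := energy_ge0 tu; set E := energy u u' u u' in E0.
(* [k ^+ 2 * E <= 1] for every [E >= 0], including [E = 0]. *)
pose k := (1 + E)^-1.
have k0 : 0 < k by rewrite invr_gt0; lra.
apply: lt_le_trans (@le_sharp_const1 (fun x => k * u x) (fun x => k * u' x) _ _).
- by rewrite JZ// mulr_gt0 ?exprn_gt0// J_gt0.
- exact: trialZ.
- rewrite energyZ// -/E /k exprVn mulrC ler_pdivrMr ?exprn_gt0//; last by lra.
  by have := sqr_ge0 E; lra.
Qed.

(** Both sides scale by [k ^+ (2 * m.+1)], so the bound on the unit ball
    extends to all trial functions. *)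
Lemma le_sharp_const u u' : trial u u' ->
  J u <= sharp_const * energy u u' u u' ^+ m.+1.
Proof.
move=> tu; have cu := trial_continuous tu.
have E0 := energy_ge0 tu; have C0 := sharp_const_gt0.
move: (E0); rewrite le_eqVlt => /predU1P[E00|Egt0].
  have Ele0 : energy u u' u u' <= 0 by rewrite -E00.
  have u0 := energy0_trivial tu Ele0.
  rewrite (@eq_integral_of _ _ (fun=> 0)) ?integral_of_cst// ?mul0r.
    by rewrite mulr_ge0 ?exprn_ge0// ltW.
  by move=> x; rewrite u0 expr0n.
set E := energy u u' u u' in E0 Egt0 *.
pose k := (Num.sqrt E)^-1.
have k2 : k ^+ 2 = E^-1 by rewrite /k exprVn sqr_sqrtr.
have := @le_sharp_const1 _ _ (trialZ k tu).
rewrite energyZ// k2 -/E mulVf ?gt_eqF// lexx JZ// exprM k2 => /(_ isT).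
by rewrite exprVn mulrC ler_pdivrMr// exprn_gt0.
Qed.

Lemma exists_maximizing_sequence : exists u_ u'_ : nat -> R -> R, forall n,
  [/\ trial (u_ n) (u'_ n), energy (u_ n) (u'_ n) (u_ n) (u'_ n) <= 1 &
    sharp_const - n.+1%:R^-1 < J (u_ n)].
Proof.
have h n : exists w : (R -> R) * (R -> R),
    [/\ trial w.1 w.2, energy w.1 w.2 w.1 w.2 <= 1 &
      sharp_const - n.+1%:R^-1 < J w.1].
  have e0 : 0 < (n.+1%:R^-1 : R) by rewrite invr_gt0.
  have [_ [u [u' [tu u1 ->]]] lt] := sup_adherent e0 energy_ball_values_has_sup.
  by exists (u, u').
have [w wP] := choice h.
by exists (fun n => (w n).1), (fun n => (w n).2).
Qed.

(** Compare [u] with [u + t * phi]: convexity bounds the nonlinear term from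
    below by its tangent, and the homogeneous inequality bounds it from above. In the
    conclusion [u] enters only through integrals of its powers against fixed
    continuous functions, so it passes to uniform limits, in which the energy
    itself need not converge. *)
Lemma maximizing_inequality u u' phi phi' phi'' t e :
  trial u u' -> energy u u' u u' <= 1 -> sharp_const - e < J u ->
  trial phi phi' -> has_derivative phi' phi'' -> continuous phi'' ->
  sharp_const - e + t * ((2 * m.+1)%:R * I (fun x => u x ^+ (2 * m).+1 * phi x)) <=
  sharp_const * (1 + 2 * t * I (fun x => u x * B phi phi'' x) +
                 t ^+ 2 * energy phi phi' phi phi') ^+ m.+1.
Proof.
move=> tu u1 Ju tphi dphi' cphi''.
have cu := trial_continuous tu; have cphi := trial_continuous tphi.
have tut := trialD tu (trialZ t tphi).
have E := energyD kappa c omega0 t tu tphi.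
have E0 := energy_ge0 tut; have JE := le_sharp_const tut.
rewrite (energy_linear_part kappa c omega0 L_gt0 tu tphi dphi' cphi'') in E.
rewrite E in E0 JE.
apply: le_trans (_ : J u + t * ((2 * m.+1)%:R * I (fun x => u x ^+ (2 * m).+1 * phi x)) <= _).
  by rewrite lerD2r ltW.
apply: le_trans (_ : _ <= J (fun x => u x + t * phi x)) _.
  rewrite -!integral_ofZ -?integral_ofD; try by solve_continuous.
  apply: le_integral_of; try by solve_continuous.
  move=> x _; apply: le_trans (even_expr_tangent m (u x) (t * phi x)).
  by rewrite le_eqVlt; apply/orP; left; apply/eqP; ring.
apply: le_trans JE _.
rewrite ler_wpM2l ?(ltW sharp_const_gt0)// lerXn2r ?nnegrE//; last by rewrite !lerD2r.
by apply: le_trans E0 _; rewrite !lerD2r.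
Qed.

(** The right-hand side minus the left-hand side is nonnegative and vanishes at
    [t = 0], so its derivative there is zero. *)
Lemma tangent_coefficient (M A G B : R) :
  (forall t, M + t * G <= M * (1 + 2 * t * A + t ^+ 2 * B) ^+ m.+1) ->
  G = M * (2 * m.+1%:R * A).
Proof.
move=> h.
pose q t := 1 + 2 * t * A + t ^+ 2 * B.
pose q' t := 2 * A + 2 * t * B.
have dq : has_derivative q q'.
  have did := @has_derivative_id R.
  apply: has_derivative_eq (has_derivativeD (has_derivative_cst 1)
    (has_derivativeD (has_derivativeZ (2 * A) did)
       (has_derivativeZ B (has_derivativeM did did)))) => t; rewrite /q /q'; ring.
have dqX k : has_derivative (fun t => q t ^+ k.+1) (fun t => k.+1%:R * q t ^+ k * q' t).
  elim: k => [|k ih].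
    by apply: has_derivative_eq dq => t; rewrite ?expr1// expr0 !mul1r.
  apply: has_derivative_eq (has_derivativeM dq ih) => t; first by rewrite -exprS.
  by rewrite !exprS -[k.+2]addn1 natrD; ring.
pose d t := M * q t ^+ m.+1 - (M + G * t).
have dd : has_derivative d (fun t => M * (m.+1%:R * q t ^+ m * q' t) - (0 + G * 1)).
  exact: (has_derivativeB (has_derivativeZ M (dqX m))
    (has_derivativeD (has_derivative_cst M) (has_derivativeZ G (@has_derivative_id R)))).
have q0 : q 0 = 1 by rewrite /q !(mulr0, mul0r, expr0n, addr0).
have d0 : d 0 = 0 by rewrite /d q0 expr1n mulr1 mulr0 addr0 subrr.
have [_ dmin] : is_derive (0 : R) (1 : R) d 0.
  apply: (@derive1_at_min R d (-1) 1 0).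
  - by lra.
  - by move=> t _; case: (dd t).
  - by rewrite in_itv/=; lra.
  - by move=> t _; rewrite d0 /d subr_ge0 mulrC h.
have [_] := dd 0; rewrite dmin q0 expr1n /q'; lra.
Qed.

(** The uniform limit of a maximizing sequence satisfies the limit of
    [maximizing_inequality] for every [t], hence the weak equation. It is not
    zero because the nonlinear term is continuous along the sequence and tends
    to a positive number. *)
Lemma exists_weak_solution : exists u,
  [/\ continuous u, odd_periodic L u, ~ (forall x, u x = 0) &
   forall phi phi' phi'', trial phi phi' -> has_derivative phi' phi'' ->
     continuous phi'' ->
     I (fun x => u x ^+ (2 * m).+1 * phi x) =
     sharp_const * I (fun x => u x * B phi phi'' x)].
Proof.
have [u_ [u'_ uP]] := exists_maximizing_sequence.
have [F [FU FN]] := @ultraFilterLemma nat \oo _.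
have K0 : 0 <= delta^-1 by rewrite invr_ge0 ltW.
have uOP n : odd_periodic L (u_ n) by case: (uP n) => -[].
have uK n : holder_bound L delta^-1 (u_ n).
  by case: (uP n) => tu u1 _; rewrite -div1r; exact: trial_holder tu u1.
have [u [OPu Ku uu]] := holder_compact L_gt0 FU K0 uOP uK.
have cu := holder_continuous L_gt0 K0 Ku.
have cu_ n : continuous (u_ n) by case: (uP n) => /trial_continuous.
have bu_ n x : `[- L, L] x -> `|u_ n x| <= delta^-1 * L + 1.
  by move=> _; exact: holder_bounded.
have bu x : `[- L, L] x -> `|u x| <= delta^-1 * L + 1.
  by move=> _; exact: holder_bounded.
have lim k psi : continuous psi ->
    I (fun x => u_ n x ^+ k * psi x) @[n --> F] --> I (fun x => u x ^+ k * psi x).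
  move=> cpsi; apply: integral_uniform_cvg => //.
  - by move=> n; exact: continuous_fX (cu_ n).
  - by solve_continuous.
  - exact: uniform_cvgX bu_ bu uu.
have epscvg : n.+1%:R^-1 @[n --> F] --> (0 : R).
  by apply: cvg_trans (@cvg_harmonic R); exact: cvg_app.
have c1 : continuous (fun _ : R => 1 : R) by move=> ?; exact: cvg_cst.
exists u; split=> //.
  move=> u0.
  have := lim (2 * m.+1)%N (fun=> 1) c1.
  rewrite (@eq_integral_of _ (fun x => u x ^+ _ * 1) (fun=> 0)); last first.
    by move=> x; rewrite u0 expr0n mul0r.
  rewrite integral_of_cst// mul0r => lim0.
  have : sharp_const - 0 <= 0.
    apply: (ler_cvg_to _ lim0 (f := fun n => sharp_const - n.+1%:R^-1)).
      by apply: cvgB => //; exact: cvg_cst.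
    apply: filterE => n; have [_ _ /ltW] := uP n; move=> /le_trans; apply.
    by under [in leRHS]eq_integral_of => x do rewrite mulr1.
  by have := sharp_const_gt0; lra.
move=> phi phi' phi'' tphi dphi' cphi''.
have cphi := trial_continuous tphi.
have clin : continuous (B phi phi'').
  by rewrite /linear_part; solve_continuous.
have limA : I (fun x => u_ n x * B phi phi'' x) @[n --> F] -->
    I (fun x => u x * B phi phi'' x).
  exact: lim 1%N _ clin.
have limG := lim (2 * m).+1 phi cphi.
apply: (@mulfI _ (2 * m.+1)%:R); first by rewrite pnatr_eq0.
have tangent t : sharp_const +
    t * ((2 * m.+1)%:R * I (fun x => u x ^+ (2 * m).+1 * phi x)) <=
    sharp_const * (1 + 2 * t * I (fun x => u x * B phi phi'' x) +
                   t ^+ 2 * energy phi phi' phi phi') ^+ m.+1.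
  have limL : sharp_const - n.+1%:R^-1 +
      t * ((2 * m.+1)%:R * I (fun x => u_ n x ^+ (2 * m).+1 * phi x)) @[n --> F] -->
      sharp_const + t * ((2 * m.+1)%:R * I (fun x => u x ^+ (2 * m).+1 * phi x)).
    apply: cvgD.
      by rewrite -[X in _ --> X]subr0; apply: cvgB => //; exact: cvg_cst.
    by do 2 (apply: cvgM; first exact: cvg_cst).
  have limR : sharp_const * (1 + 2 * t * I (fun x => u_ n x * B phi phi'' x) +
                   t ^+ 2 * energy phi phi' phi phi') ^+ m.+1 @[n --> F] -->
      sharp_const * (1 + 2 * t * I (fun x => u x * B phi phi'' x) +
                   t ^+ 2 * energy phi phi' phi phi') ^+ m.+1.
    apply: cvgM; first exact: cvg_cst.
    apply: (continuous_cvg _ (@exprn_continuous _ m.+1 _)).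
    apply: cvgD; last exact: cvg_cst.
    apply: cvgD; first exact: cvg_cst.
    by apply: cvgM => //; exact: cvg_cst.
  apply: (ler_cvg_to limL limR); apply: filterE => n.
  case: (uP n) => tu u1 Ju.
  exact: (maximizing_inequality t tu u1 Ju tphi dphi' cphi'').
by rewrite (tangent_coefficient tangent) natrM; ring.
Qed.

End Maximizer.

(** * Regularity of weak solutions *)

Section Regularity.
Variables (R : realType) (L kappa c omega0 M : R) (p : nat).
Hypotheses (L_gt0 : 0 < L) (c_neq0 : c != 0) (M_gt0 : 0 < M) (p_odd : odd p).
Local Notation I f := (integral_of f (- L) L).

(** Let [U] be the odd periodic solution of [U'' = g], where [g] collects the
    terms of the equation without derivatives. The weak equation then says that
    [h = c ^+ 2 * u - U] is orthogonal to [phi''] for every test function.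
    Solving [phi'' = h] gives that [h] is orthogonal to itself, so [u] is [U] up
    to the factor [c ^+ 2]. *)
Lemma weak_solution_regular (u : R -> R) : continuous u -> odd_periodic L u ->
  (forall phi phi' phi'', trial L phi phi' -> has_derivative phi' phi'' ->
     continuous phi'' ->
     I (fun x => u x ^+ p * phi x) =
     M * I (fun x => u x * linear_part kappa c omega0 phi phi'' x)) ->
  exists u' u'', [/\ has_derivative u u', has_derivative u' u'' &
    forall x, c ^+ 2 * u'' x =
      kappa * (u (x + 1) - 2 * u x + u (x - 1)) + omega0 ^+ 2 * u x
      - M^-1 * u x ^+ p].
Proof.
move=> cu uOP weak.
have M0 : M != 0 by rewrite gt_eqF.
pose g x := kappa * (u (x + 1) - 2 * u x + u (x - 1)) + omega0 ^+ 2 * u x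
      - M^-1 * u x ^+ p.
have cg : continuous g by rewrite /g; solve_continuous.
have gOP : odd_periodic L g.
  apply: odd_periodicB; last by apply: odd_periodicZ; exact: odd_periodicX.
  apply: odd_periodicD; last exact: odd_periodicZ.
  by apply: odd_periodicZ; exact: odd_periodic_laplacian.
have [U [U' [UOP dU dU']]] := odd_periodic_second_primitive L_gt0 cg gOP.
have cU := has_derivative_continuous dU; have cU' := has_derivative_continuous dU'.
pose h x := c ^+ 2 * u x - U x.
have ch : continuous h by rewrite /h; solve_continuous.
have hOP : odd_periodic L h by apply: odd_periodicB => //; exact: odd_periodicZ.
have [phi [phi' [pOP dphi dphi']]] := odd_periodic_second_primitive L_gt0 ch hOP.
have cphi := has_derivative_continuous dphi.
have cphi' := has_derivative_continuous dphi'.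
(* The test function is chosen so that its second derivative is [h]. *)
have weakh := weak phi phi' h (And3 pOP dphi cphi') dphi' ch.
have [[_ uT] [_ UT] [_ pT]] := And3 uOP UOP pOP.
have U'T := derivative_periodic UT dU.
have p'T := derivative_periodic pT dphi.
have sh1 : I (fun x => u (x + 1) * phi x) = I (fun x => u x * phi (x - 1)).
  rewrite -(@integral_shift _ _ L_gt0 (fun x => u x * phi (x - 1)) 1).
  - by apply: eq_integral_of => x; rewrite addrK.
  - by solve_continuous.
  - by move=> x; rewrite uT [x + 2 * L - 1]addrAC pT.
have sh2 : I (fun x => u (x - 1) * phi x) = I (fun x => u x * phi (x + 1)).
  rewrite -(@integral_shift _ _ L_gt0 (fun x => u x * phi (x + 1)) (-1)).
  - by apply: eq_integral_of => x; rewrite subrK.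
  - by solve_continuous.
  - by move=> x; rewrite uT [x + 2 * L + 1]addrAC pT.
have Ug : I (fun x => U x * h x) = I (fun x => g x * phi x).
  have e1 : I (fun x => U' x * phi' x) = - I (fun x => U x * h x).
    exact: integration_by_parts_periodic.
  have e2 : I (fun x => g x * phi x) = - I (fun x => U' x * phi' x).
    exact: integration_by_parts_periodic.
  by rewrite e2 e1 opprK.
have eg : I (fun x => g x * phi x) =
    kappa * (I (fun x => u (x + 1) * phi x) - 2 * I (fun x => u x * phi x)
       + I (fun x => u (x - 1) * phi x)) + omega0 ^+ 2 * I (fun x => u x * phi x)
    - M^-1 * I (fun x => u x ^+ p * phi x).
  rewrite /g -!(integral_ofB, integral_ofD, integral_ofZ); try by solve_continuous.
  by apply: eq_integral_of => x; ring.
have el : I (fun x => u x * linear_part kappa c omega0 phi h x) =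
  - c ^+ 2 * I (fun x => u x * h x) + omega0 ^+ 2 * I (fun x => u x * phi x)
  + kappa * (I (fun x => u x * phi (x + 1)) - 2 * I (fun x => u x * phi x)
     + I (fun x => u x * phi (x - 1))).
  rewrite /linear_part -!(integral_ofB, integral_ofD, integral_ofZ); try by solve_continuous.
  by apply: eq_integral_of => x; ring.
have hh0 : I (fun x => h x ^+ 2) = 0.
  have -> : I (fun x => h x ^+ 2) = c ^+ 2 * I (fun x => u x * h x) - I (fun x => U x * h x).
    rewrite -!(integral_ofB, integral_ofZ); try by solve_continuous.
    by apply: eq_integral_of => x; rewrite /h; ring.
  by rewrite Ug eg weakh mulKf// el sh1 sh2; ring.
have h0 x : h x = 0.
  have ho y : - L < y < L -> h y = 0.
    move=> yL; apply/eqP; rewrite -sqrf_eq0; apply/eqP.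
    apply: (@integral_of_eq0 _ (fun x => h x ^+ 2) (- L) L) => //.
      by solve_continuous.
    by move=> z; exact: sqr_ge0.
  have [y yL ->] := reduce_mod_period L_gt0 x; last exact: hOP.2.
  have hL := odd_periodic_atL hOP.
  have [->|yL1] := eqVneq y L; first by [].
  have [->|yL2] := eqVneq y (- L); first by rewrite hOP.1 hL oppr0.
  by apply: ho; rewrite !lt_neqAle yL1 eq_sym yL2.
have c2 : c ^+ 2 != 0 by rewrite expf_neq0.
have uE x : (c ^+ 2)^-1 * U x = u x.
  have /eqP := h0 x; rewrite subr_eq0 => /eqP <-.
  by rewrite mulKf.
exists (fun x => (c ^+ 2)^-1 * U' x), (fun x => (c ^+ 2)^-1 * g x); split.
- exact: has_derivative_eq uE (fun=> erefl) (has_derivativeZ (c ^+ 2)^-1 dU).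
- exact: has_derivativeZ.
- by move=> x; rewrite mulVKf.
Qed.

End Regularity.

(** * From profiles to travelling waves on the lattice *)

Section Profiles.
Variable R : realType.
Local Notation mu := (@lebesgue_measure R).

Lemma continuous_L2_interval (L : R) (f : R -> R) : continuous f -> L2_interval L f.
Proof.
move=> cf; rewrite /L2_interval.
have mD : measurable (`[- L, L] : set R) by exact: measurable_itv.
rewrite inE; apply/andP; split; rewrite inE.
  apply/(measurable_restrictT _ _).1 => //.
  by apply: measurable_funTS; exact: continuous_measurable_fun.
rewrite /= /finite_norm unlock /Lnorm poweR_lty//.
have cf2 : continuous (fun x => f x ^+ 2) by exact: continuous_fX.
have /integrableP[_] := continuous_integrable (- L) L cf2.
apply: le_lt_trans; rewrite [leRHS]integral_mkcond.
rewrite le_eqVlt; apply/orP; left; apply/eqP.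
apply: eq_integral => x _ /=; rewrite /patch /=.
case: ifPn => xD /=; last by rewrite normr0 powR0.
by rewrite powR_mulrn// normrX.
Qed.

Lemma trial_H1per (L : R) (Q Q' : R -> R) : 0 < L -> trial L Q Q' -> H1per L Q.
Proof.
move=> L0 [[_ QT] dQ cQ']; have cQ := has_derivative_continuous dQ.
split=> //; first exact: continuous_L2_interval.
exists Q'; first exact: continuous_L2_interval.
move=> phi sphi phiT.
have dphi : has_derivative phi (derive1 phi).
  by move=> x; rewrite derive1E; apply: derivableP; exact: (sphi 0%N).
have cphi' : continuous (derive1 phi).
  move=> x; apply/differentiable_continuous/derivable1_diffP; exact: (sphi 1%N).
have := @integration_by_parts_periodic R L L0 Q phi Q' (derive1 phi) dQ dphi cQ' cphi' QT phiT.
by rewrite /integral_of => ->; rewrite opprK.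
Qed.

Lemma derive1_potential (omega0 a : R) (p : nat) :
  derive1 (potential omega0 a p) = fun x => - omega0 ^+ 2 * x + a * x ^+ p.
Proof.
have dX k : has_derivative (fun x : R => x ^+ k.+1) (fun x => k.+1%:R * x ^+ k).
  elim: k => [|k ih].
    by apply: has_derivative_eq (@has_derivative_id R) => x; rewrite ?expr1// expr0 mulr1.
  apply: has_derivative_eq (has_derivativeM (@has_derivative_id R) ih) => x.
    by rewrite -exprS.
  by rewrite !exprS -[k.+2]addn1 natrD; ring.
apply: derive1_has_derivative.
apply: has_derivative_eq (has_derivativeD
  (has_derivativeZ (- (omega0 ^+ 2 / 2)) (dX 1%N))
  (has_derivativeZ (a / p.+1%:R) (dX p))) => // x.
rewrite expr1; congr (_ + _); first by field.
by rewrite mulrA divfK// pnatr_eq0.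
Qed.

Lemma lattice_solution_of_profile (kappa c : R) (V Q Q' Q'' : R -> R) :
  has_derivative Q Q' -> has_derivative Q' Q'' ->
  (forall z, c ^+ 2 * Q'' z =
     kappa * (Q (z + 1) - 2 * Q z + Q (z - 1)) - derive1 V (Q z)) ->
  lattice_solution kappa V (travelling_wave c Q).
Proof.
move=> dQ dQ' eqQ n t.
have dlin : has_derivative (fun t => n%:~R - c * t) (fun=> - c).
  apply: has_derivative_eq (has_derivativeB (has_derivative_cst (n%:~R))
    (has_derivativeZ c (@has_derivative_id R))) => // x.
  by rewrite mulr1 sub0r.
have d1 : has_derivative (travelling_wave c Q n) (fun t => - c * Q' (n%:~R - c * t)).
  by apply: has_derivative_eq (has_derivative_comp dQ dlin) => // x; rewrite mulrC.
have d2 : has_derivative (fun t => - c * Q' (n%:~R - c * t))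
    (fun t => c ^+ 2 * Q'' (n%:~R - c * t)).
  apply: has_derivative_eq (has_derivativeZ (- c) (has_derivative_comp dQ' dlin)) => // x.
  by ring.
have e1 := derive1_has_derivative d1; have e2 := derive1_has_derivative d2.
rewrite derive1nS derive1n1 e1 e2; split; [by case: (d1 t)|by case: (d2 t)|].
rewrite eqQ /travelling_wave intrD intrB.
by rewrite [n%:~R + 1 - _]addrAC [n%:~R - 1 - _]addrAC.
Qed.

Lemma lattice_periodic_of_profile (L c : R) (Q : R -> R) : periodic Q (2 * L) ->
  lattice_periodic L (travelling_wave c Q).
Proof.
move=> QT N NL n; apply/funext => t; rewrite /travelling_wave intrD.
by rewrite -pmulrn NL addrAC QT.
Qed.

End Profiles.

Lemma exists_pos_root (R : realType) (y : R) (n : nat) : (0 < n)%N -> 0 < y ->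
  exists2 s, 0 < s & s ^+ n = y.
Proof.
move=> n0 y0; exists (y `^ n%:R^-1); first exact: powR_gt0.
rewrite -powR_mulrn ?powR_ge0// -powRrM mulVf ?powRr1 ?ltW//.
by rewrite pnatr_eq0 -lt0n.
Qed.

Lemma X1_of_profile (R : realType) (L omega0 a : R) (p : nat) (Q Q' : R -> R) :
  0 < L -> odd p -> trial L Q Q' -> X1 (potential omega0 a p) L Q.
Proof.
move=> L0 op tQ; have cQ := trial_continuous tQ; have [QOP _ _] := tQ.
have [QN _] := QOP.
split.
- exact: trial_H1per L0 tQ.
- exact: (integral_odd L0 cQ QN).
- rewrite derive1_potential.
  apply: (@integral_odd _ _ L0 (fun s => - omega0 ^+ 2 * Q s + a * Q s ^+ p)).
    by solve_continuous.
  suff [] : odd_periodic L (fun s => - omega0 ^+ 2 * Q s + a * Q s ^+ p) by [].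
  by apply: odd_periodicD; apply: odd_periodicZ => //; exact: odd_periodicX.
- by move=> s; rewrite -QN opprB.
Qed.

(** The maximizer [u] solves [linear_part u u'' = M^-1 * u ^+ p]; the multiple
    [s * u] turns the coefficient [M^-1] into [a] when [s ^+ p.-1 = (a * M)^-1]. *)
Theorem mainTheorem4 (R : realType) (kappa L c omega0 a : R) (p : nat)
    (hkappa : 0 < kappa) (hL : 0 < L) (hc : c != 0)
    (ha : 0 < a) (hp : (1 < p)%N) (hodd : odd p)
    (hcase : 4 * kappa <= omega0 ^+ 2 \/
             (omega0 ^+ 2 < 4 * kappa /\
              poincare_const L * (4 * kappa - omega0 ^+ 2) < c ^+ 2)) :
  exists Q : R -> R,
    periodic_TWS kappa (potential omega0 a p) L c Q /\
    ~ (forall z : R, Q z = 0).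
Proof.
have [delta delta0 coercive] := energy_coercive hL hkappa hc hcase.
pose m := p./2.
have pE : p = (2 * m).+1.
  by rewrite -[LHS](odd_double_half p) hodd add1n -mul2n.
have m0 : (0 < 2 * m)%N by move: hp; rewrite {1}pE.
have [u [cu uOP uN0 weak]] := exists_weak_solution m hL delta0 coercive.
have M0 := sharp_const_gt0 m hL delta0 coercive.
set M := sharp_const _ _ _ _ _ in weak M0.
rewrite -pE in weak.
have [u' [u'' [du du' equ]]] := weak_solution_regular hL hc M0 hodd cu uOP weak.
have [s s0 sE] := exists_pos_root m0 (y := (a * M)^-1) (ltac:(by rewrite invr_gt0 mulr_gt0)).
pose Q x := s * u x; pose Q' x := s * u' x; pose Q'' x := s * u'' x.
have dQ : has_derivative Q Q' by exact: has_derivativeZ.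
have dQ' : has_derivative Q' Q'' by exact: has_derivativeZ.
have tQ : trial L Q Q'.
  split=> //; first exact: odd_periodicZ.
  exact: has_derivative_continuous dQ'.
exists Q; split; last first.
  move=> Q0; apply: uN0 => x; have /eqP := Q0 x.
  by rewrite mulf_eq0 gt_eqF//= => /eqP.
split; first exact: X1_of_profile tQ.
  by apply: lattice_periodic_of_profile; case: tQ => -[].
apply: lattice_solution_of_profile dQ dQ' _ => z.
rewrite derive1_potential /Q'' mulrCA equ /Q exprMn.
have -> : s ^+ p = s / (a * M) by rewrite {1}pE exprS sE.
have aM0 : a != 0 /\ M != 0 by rewrite !gt_eqF.
by field; rewrite !gt_eqF.
Qed.
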